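(* Let $R$ be a commutative ring with identity, $S$ a multiplicative subset of $R$, $I$ an ideal of $R$ disjoint from $S$, and $n$ a positive integer. If $IR_S$ is an $n$-absorbing ideal of $R_S$ and $\mathrm{Sat}_S(I)=I:s$ for some $s\in S$, then $I$ is an $S$-$n$-absorbing ideal of $R$. Moreover, the converse holds if $R$ is locally divided: that is, if $R$ is locally divided and $I$ is an $S$-$n$-absorbing ideal of $R$, then $IR_S$ is an $n$-absorbing ideal of $R_S$ and $\mathrm{Sat}_S(I)=I:s$ for some $s\in S$.
   Context: A multiplicative subset $S$ of $R$ is a nonempty subset closed under multiplication (not necessarily saturated, and not required to contain $1$). $R_S$ is the localization of $R$ at $S$, and $IR_S$ is the extension of $I$ to $R_S$. An ideal $I$ of $R$ is $n$-absorbing if whenever $r_1,\dots,r_{n+1}\in R$ satisfy $r_1\cdots r_{n+1}\in I$, there is $1\le j\le n+1$ with $\prod_{1\le i\le n+1,\, i\ne j} r_i\in I$. An ideal $I$ of $R$ disjoint from $S$ is $S$-$n$-absorbing if there exists $s\in S$ such that whenever $r_1,\dots,r_{n+1}\in R$ satisfy $r_1\cdots r_{n+1}\in I$, there is $1\le j\le n+1$ with $s\prod_{1\le i\le n+1,\, i\ne j} r_i\in I$. For $s\in R$, $I:s=\{r\in R : sr\in I\}$. The $S$-saturation of $I$ is $\mathrm{Sat}_S(I)=\{x\in R : xs\in I \text{ for some } s\in S\}$, i.e. the contraction of $IR_S$ to $R$. An ideal $I$ of a commutative ring $R$ is divided if for each $a\in R$, either $a\in I$ or $I\subsetneq aR$.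 A ring is divided if each of its prime ideals is divided, and $R$ is locally divided if $R_M$ is a divided ring for each maximal ideal $M$ of $R$. *)

(* Defs.v *)
From HB Require Import structures.
From mathcomp Require Import all_boot all_algebra.
From mathcomp Require Import generic_quotient ring.
From mathcomp Require Import boolp classical_sets.

Set Implicit Arguments.
Unset Strict Implicit.
Unset Printing Implicit Defensive.

Import GRing.Theory.
Local Open Scope ring_scope.
Local Open Scope classical_set_scope.
Local Open Scope quotient_scope.

(* Rings are [comPzRingType]s, so that the zero ring is allowed: it is the
   localization at any multiplicative subset containing 0.  The library's
   [idealr] is not used, as it only covers decidable proper ideals of nonzero
   rings. *)

Section Ideals.
Variable R : comPzRingType.

Definition is_ideal (I : set R) : Prop :=
  [/\ I 0, forall x y, I x -> I y -> I (x + y) & forall r x, I x -> I (r * x)].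

Definition is_prime_ideal (P : set R) : Prop :=
  [/\ is_ideal P, P <> [set: R] & forall x y, P (x * y) -> P x \/ P y].

Definition is_maximal_ideal (M : set R) : Prop :=
  [/\ is_ideal M, M <> [set: R]
    & forall J : set R, is_ideal J -> M `<=` J -> J = M \/ J = [set: R]].

Definition principal_ideal (a : R) : set R := [set a * r | r in [set: R]].

Definition ideal_generated (X : set R) : set R := smallest is_ideal X.

Definition ideal_colon (I : set R) (s : R) : set R := [set r | I (s * r)].

Definition absorbing (n : nat) (I : set R) : Prop :=
  is_ideal I /\
  forall r : 'I_n.+1 -> R, I (\prod_(i < n.+1) r i) ->
    exists j : 'I_n.+1, I (\prod_(i < n.+1 | i != j) r i).

Definition divided_ideal (I : set R) : Prop :=
  forall a : R, I a \/ I `<` principal_ideal a.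

Definition divided_ring : Prop :=
  forall P : set R, is_prime_ideal P -> divided_ideal P.

End Ideals.

Record mulSubset (R : comPzRingType) := MulSubset {
  mulSubset_set :> set R;
  mulSubset_nonempty : mulSubset_set !=set0;
  mulSubset_mul : forall x y : R,
    mulSubset_set x -> mulSubset_set y -> mulSubset_set (x * y)
}.

Section SIdeals.
Variables (R : comPzRingType) (S : mulSubset R).

Definition S_absorbing (n : nat) (I : set R) : Prop :=
  [/\ is_ideal I, I `&` S = set0
    & exists2 s : R, (S : set R) s &
      forall r : 'I_n.+1 -> R, I (\prod_(i < n.+1) r i) ->
        exists j : 'I_n.+1, I (s * \prod_(i < n.+1 | i != j) r i)].

Definition S_saturation (I : set R) : set R :=
  [set x | exists2 s : R, (S : set R) s & I (x * s)].

End SIdeals.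

Module Localization.
Section Localization.
Variables (R : comPzRingType) (S : mulSubset R).

Definition denominator := {x : R | x \in (S : set R)}.

HB.instance Definition _ := Choice.on denominator.

Implicit Types (a b : R) (s t : denominator) (f g h : R * denominator).

Lemma denominator_mul_subproof s t : sval s * sval t \in (S : set R).
Proof.
by apply/mem_set/mulSubset_mul; apply/set_mem; [exact: (svalP s)|exact: (svalP t)].
Qed.

Definition dmul s t : denominator :=
  exist (fun x => is_true (x \in (S : set R))) _ (denominator_mul_subproof s t).

Lemma denominator_base_subproof :
  sval (cid (mulSubset_nonempty S)) \in (S : set R).
Proof. exact/mem_set/(svalP (cid (mulSubset_nonempty S))). Qed.

(* S need not contain 1, so an arbitrary element of S serves to write the
   fractions 0 = 0/s, 1 = s/s and a = (as)/s. *)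
Definition base : denominator :=
  exist (fun x => is_true (x \in (S : set R))) _ denominator_base_subproof.

Definition equivf f g : bool :=
  `[< exists u : denominator,
        sval u * (f.1 * sval g.2) = sval u * (g.1 * sval f.2) >].

Lemma equivf_refl : reflexive equivf.
Proof. by move=> f; apply/asboolP; exists base. Qed.

Lemma equivf_sym : symmetric equivf.
Proof.
by move=> f g; apply/asboolP/asboolP => -[u e]; exists u; rewrite e.
Qed.

Lemma equivf_trans : transitive equivf.
Proof.
move=> [b t] [a s] [c v] /asboolP[u /= e1] /asboolP[w /= e2].
apply/asboolP; exists (dmul (dmul u w) t) => /=.
transitivity (sval w * sval v * (sval u * (a * sval t))); first by ring.
rewrite e1; transitivity (sval u * sval s * (sval w * (b * sval v))); first by ring.
by rewrite e2; ring.
Qed.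

Canonical equivf_equiv := EquivRel equivf equivf_refl equivf_sym equivf_trans.

Definition type := {eq_quot equivf}.

HB.instance Definition _ : EqQuotient _ equivf type := EqQuotient.on type.
HB.instance Definition _ := Choice.on type.

Definition fraction a s : type := \pi_type (a, s).

Lemma fractionP a s b t :
  fraction a s = fraction b t <->
  exists u : denominator, sval u * (a * sval t) = sval u * (b * sval s).
Proof.
split; first by move=> /eqmodP/asboolP.
by move=> e; apply/eqmodP/asboolP.
Qed.

Lemma fractionW (P : type -> Prop) :
  (forall a s, P (fraction a s)) -> forall x, P x.
Proof. by move=> h; elim/quotW => -[a s]; exact: h. Qed.

Definition num (x : type) : R := (repr x).1.
Definition den (x : type) : denominator := (repr x).2.

Lemma num_den x : fraction (num x) (den x) = x.
Proof. by rewrite /fraction /num /den -surjective_pairing reprK. Qed.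

Definition add (x y : type) : type :=
  fraction (num x * sval (den y) + num y * sval (den x)) (dmul (den x) (den y)).
Definition opp (x : type) : type := fraction (- num x) (den x).
Definition mul (x y : type) : type :=
  fraction (num x * num y) (dmul (den x) (den y)).
Definition zero : type := fraction 0 base.
Definition one : type := fraction (sval base) base.

Lemma num_denP a s : exists u : denominator,
  sval u * (num (fraction a s) * sval s)
    = sval u * (a * sval (den (fraction a s))).
Proof. exact/fractionP/num_den. Qed.

Lemma addE a s b t :
  add (fraction a s) (fraction b t)
    = fraction (a * sval t + b * sval s) (dmul s t).
Proof.
rewrite /add; have [w] := num_denP b t; have [u] := num_denP a s.
set a' := num _; set s' := den _; set b' := num _; set t' := den _ => e1 e2.
apply/fractionP; exists (dmul u w) => /=.
transitivity (sval w * sval t * sval t' * (sval u * (a' * sval s))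
  + sval u * sval s * sval s' * (sval w * (b' * sval t))); first by ring.
by rewrite e1 e2; ring.
Qed.

Lemma oppE a s : opp (fraction a s) = fraction (- a) s.
Proof.
rewrite /opp; have [u e] := num_denP a s; apply/fractionP; exists u.
by rewrite !mulNr !mulrN e.
Qed.

Lemma mulE a s b t :
  mul (fraction a s) (fraction b t) = fraction (a * b) (dmul s t).
Proof.
rewrite /mul; have [w] := num_denP b t; have [u] := num_denP a s.
set a' := num _; set s' := den _; set b' := num _; set t' := den _ => e1 e2.
apply/fractionP; exists (dmul u w) => /=.
transitivity ((sval u * (a' * sval s)) * (sval w * (b' * sval t))); first by ring.
by rewrite e1 e2; ring.
Qed.

Ltac solve_fraction :=
  by rewrite /zero /one ?(addE, oppE, mulE); apply/fractionP; exists base => /=; ring.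

Lemma addA : associative add.
Proof.
by elim/fractionW => a s; elim/fractionW => b t; elim/fractionW => c v; solve_fraction.
Qed.

Lemma addC : commutative add.
Proof. by elim/fractionW => a s; elim/fractionW => b t; solve_fraction. Qed.

Lemma add0 : left_id zero add.
Proof. by elim/fractionW => a s; solve_fraction. Qed.

Lemma addN : left_inverse zero opp add.
Proof. by elim/fractionW => a s; solve_fraction. Qed.

HB.instance Definition _ := GRing.isZmodule.Build type addA addC add0 addN.

Lemma mulA : associative mul.
Proof.
by elim/fractionW => a s; elim/fractionW => b t; elim/fractionW => c v; solve_fraction.
Qed.

Lemma mulC : commutative mul.
Proof. by elim/fractionW => a s; elim/fractionW => b t; solve_fraction. Qed.

Lemma mul1 : left_id one mul.
Proof. by elim/fractionW => a s; solve_fraction. Qed.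

Lemma mulDl : left_distributive mul add.
Proof.
by elim/fractionW => a s; elim/fractionW => b t; elim/fractionW => c v; solve_fraction.
Qed.

HB.instance Definition _ :=
  GRing.Zmodule_isComPzRing.Build type mulA mulC mul1 mulDl.

Definition inj a : type := fraction (a * sval base) base.

Lemma inj_is_zmod_morphism : zmod_morphism inj.
Proof.
by move=> a b; rewrite /inj; change (fraction ((a - b) * sval base) base =
  add (fraction (a * sval base) base) (opp (fraction (b * sval base) base)));
  solve_fraction.
Qed.

Lemma inj_is_monoid_morphism : monoid_morphism inj.
Proof.
split; first by change (inj 1 = one); rewrite /inj; solve_fraction.
by move=> a b; change (inj (a * b) = mul (inj a) (inj b)); rewrite /inj; solve_fraction.
Qed.

HB.instance Definition _ := GRing.isZmodMorphism.Build R type inj inj_is_zmod_morphism.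
HB.instance Definition _ := GRing.isMonoidMorphism.Build R type inj inj_is_monoid_morphism.

End Localization.
End Localization.

HB.export Localization.

Definition localization (R : comPzRingType) (S : mulSubset R) : comPzRingType :=
  Localization.type S.

Definition to_localization (R : comPzRingType) (S : mulSubset R) :
  {rmorphism R -> localization S} := @Localization.inj R S.

Definition extension (R : comPzRingType) (S : mulSubset R) (I : set R) :
  set (localization S) := ideal_generated (to_localization S @` I).

Arguments extension {R} S I.

Section AtMaximal.
Variables (R : comPzRingType) (M : set R) (maxM : is_maximal_ideal M).

Lemma maximal_not1 : (~` M) 1.
Proof.
case: maxM => -[_ _ MM] + _ M1; apply.
by apply/seteqP; split=> // x _; rewrite -[x]mulr1; exact: MM.
Qed.

Lemma maximal_compl_nonempty : ~` M !=set0.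
Proof. by exists 1; exact: maximal_not1. Qed.

Lemma maximal_compl_mul x y : (~` M) x -> (~` M) y -> (~` M) (x * y).
Proof.
move=> Mx My Mxy; case: maxM => -[M0 MD MM] _ max.
pose J := [set z | exists m r, M m /\ z = m + r * x].
have idJ : is_ideal J.
  split.
  - by exists 0, 0; split=> //; ring.
  - move=> _ _ [m [r [Mm ->]]] [m' [r' [Mm' ->]]].
    by exists (m + m'), (r + r'); split; [exact: MD|ring].
  - move=> c _ [m [r [Mm ->]]].
    by exists (c * m), (c * r); split; [exact: MM|ring].
have MJ : M `<=` J by move=> m Mm; exists m, 0; split=> //; ring.
case: (max J idJ MJ) => eJ.
  by apply: Mx; rewrite -eJ; exists 0, 1; split=> //; ring.
have [m [r [Mm e]]] : J 1 by rewrite eJ.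
apply: My; have -> : y = y * m + r * (x * y).
  by transitivity (1 * y); [ring|rewrite e; ring].
by apply: MD; exact: MM.
Qed.

Definition maximal_compl : mulSubset R :=
  MulSubset maximal_compl_nonempty maximal_compl_mul.

End AtMaximal.

Definition locally_divided (R : comPzRingType) : Prop :=
  forall (M : set R) (maxM : is_maximal_ideal M),
    divided_ring (localization (maximal_compl maxM)).

(* Main.v *)
(* The forward direction and the absorption property of IR_S amount to clearing
   denominators. For the equality Sat_S(I) = I : s', first replace I by
   I : s^(2n), which is n-absorbing without the factor s and has the same saturation. The
   radical of an n-absorbing ideal admits at most n nonzero pairwise orthogonal
   elements modulo itself, so some t in S carries its whole saturation into it.
   Local dividedness then shows that t^n carries Sat_S(I) into I. *)
Require Import Defs.
From mathcomp Require Import all_boot all_algebra.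
From mathcomp Require Import ring zify.
From mathcomp Require Import boolp classical_sets.
Import GRing.Theory.

Local Open Scope ring_scope.
Local Open Scope classical_set_scope.

(** * Absorption up to a factor, and radicals *)

(** Keeping the multiplier [s] explicit treats both notions at once: [s = 1] is ordinary absorption,
    [s] in [S] is the relative one. *)
Definition absorbing_upto {R : comPzRingType} (n : nat) (s : R) (I : set R) :=
  forall r : 'I_n.+1 -> R, I (\prod_(i < n.+1) r i) ->
    exists j : 'I_n.+1, I (s * \prod_(i < n.+1 | i != j) r i).

(** The exponent 0 is harmless for an ideal: [I 1] already makes [I] the whole ring. *)
Definition ideal_radical {R : comPzRingType} (I : set R) : set R :=
  [set x | exists N : nat, I (x ^+ N)].

Section Ideals.
Context {R : comPzRingType}.
Implicit Types (I J K T : set R) (a b r s t x y z : R).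

Lemma ideal0 {I} : is_ideal I -> I 0.
Proof. by case. Qed.

Lemma idealD {I x y} : is_ideal I -> I x -> I y -> I (x + y).
Proof. by case=> _ + _; apply. Qed.

Lemma idealMl {I} r {x} : is_ideal I -> I x -> I (r * x).
Proof. by case=> _ _; apply. Qed.

Lemma idealMr {I} r {x} : is_ideal I -> I x -> I (x * r).
Proof. by rewrite mulrC; exact: idealMl. Qed.

Lemma idealB {I x y} : is_ideal I -> I x -> I y -> I (x - y).
Proof. by move=> iI Ix Iy; apply: idealD => //; rewrite -mulN1r; exact: idealMl. Qed.

Lemma ideal_sum {I} (T : finType) (P : pred T) (F : T -> R) :
  is_ideal I -> (forall i, P i -> I (F i)) -> I (\sum_(i | P i) F i).
Proof.
move=> iI IF; elim/big_ind: _ => //; first exact: ideal0.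
by move=> x y; exact: idealD.
Qed.

Lemma ideal_colonP {I} s : is_ideal I -> is_ideal (ideal_colon I s).
Proof.
move=> iI; split=> [|x y|r x]; rewrite /ideal_colon /=.
- by rewrite mulr0; exact: ideal0.
- by rewrite mulrDr; exact: idealD.
- by rewrite mulrCA; exact: idealMl.
Qed.

Lemma ideal_radicalP {I} : is_ideal I -> is_ideal (ideal_radical I).
Proof.
move=> iI; split=> [|x y [N Ix] [M Iy]|r x [N Ix]].
- by exists 1%N; rewrite expr1; exact: ideal0.
- exists (N + M)%N; rewrite exprDn; apply: ideal_sum => // i _.
  rewrite -mulr_natr; apply: idealMr => //.
  have [le_iM|lt_Mi] := leqP i M.
    by rewrite -addnBA // exprD -mulrA; exact: idealMr.
  by rewrite -(subnK (ltnW lt_Mi)) exprD mulrA; exact: idealMl.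
- by exists N; rewrite exprMn; exact: idealMl.
Qed.

Lemma radical_idealX {I x} m : ideal_radical I (x ^+ m) -> ideal_radical I x.
Proof. by case=> N; rewrite -exprM; exists (m * N)%N. Qed.

Lemma prod_scale n (P : pred 'I_n) (t : R) (r : 'I_n -> R) :
  \prod_(i | P i) (t * r i) = t ^+ #|P| * \prod_(i | P i) r i.
Proof. by rewrite big_split /= prodr_const. Qed.

Lemma prod_scale_but1 n (j : 'I_n.+1) (t : R) (r : 'I_n.+1 -> R) :
  \prod_(i | i != j) (t * r i) = t ^+ n * \prod_(i | i != j) r i.
Proof. by rewrite prod_scale cardC1 card_ord. Qed.

(** Absorption for [a] and [n] copies of [b]: the omitted factor is either [a] or one of the
    copies. *)
Lemma absorbing_uptoX {n s I a b} : absorbing_upto n s I ->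
  I (a * b ^+ n) -> I (s * b ^+ n) \/ I (s * (a * b ^+ n.-1)).
Proof.
move=> absI Iab; pose r (i : 'I_n.+1) := if i == ord0 then a else b.
have rE (P : pred 'I_n.+1) : (forall i, P i -> i != ord0) ->
    \prod_(i | P i) r i = b ^+ #|P|.
  move=> P0; rewrite -prodr_const; apply: eq_bigr => i Pi.
  by rewrite /r (negbTE (P0 i Pi)).
have [|j] := absI r.
  by rewrite (bigD1 ord0) //= rE // {1}/r eqxx cardC1 card_ord.
have [->|j0] := eqVneq j ord0; first by rewrite rE // cardC1 card_ord; left.
rewrite (bigD1 ord0) 1?eq_sym //= rE => [|i /andP[]//].
rewrite {1}/r eqxx; have -> : #|(fun i : 'I_n.+1 => (i != j) && (i != ord0))| = n.-1.
  have /eqP := cardD1 j (predC1 (ord0 : 'I_n.+1)).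
  rewrite cardC1 card_ord !inE j0 add1n => /eqP /= /(congr1 predn) ->.
  by apply: eq_card => i; rewrite !inE.
by right.
Qed.

Lemma absorbing1 n I : absorbing n I <-> is_ideal I /\ absorbing_upto n 1 I.
Proof.
split=> -[iI absI]; split=> // r /absI[j Ij]; exists j; first by rewrite mul1r.
by rewrite -[X in I X]mul1r.
Qed.

(** Descent on the exponent: above [n], absorption for [x ^+ (N.+1 - n)] and [n] copies of [x]
    yields either [x ^+ n] or [x ^+ N]. *)
Lemma absorbing_expr {n I x} N :
  (0 < n)%N -> absorbing n I -> I (x ^+ N) -> I (x ^+ n).
Proof.
move=> n_gt0 /absorbing1[iI absI].
elim: N => [|N IH] Ix; first by rewrite -[_ ^+ n]mulr1; exact: idealMl.
have [leNn|ltnN] := leqP N.+1 n.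
  by rewrite -(subnK leNn) exprD; exact: idealMl.
move: Ix; rewrite -{1}(subnK (ltnW ltnN)) exprD.
case/(absorbing_uptoX absI); rewrite !mul1r // -exprD => Ix; apply: IH.
suff <- : (N.+1 - n + n.-1 = N)%N by [].
by case: n n_gt0 ltnN {Ix absI} => // n _ ltnN; rewrite subSS subnK // -ltnS ltnW.
Qed.

(** Powers commute with products, so absorption in [I] is applied to the [r i ^+ N]. *)
Lemma absorbing_radical {n I} : absorbing n I -> absorbing n (ideal_radical I).
Proof.
case=> iI absI; split=> [|r [N]]; first exact: ideal_radicalP.
by rewrite -prodrXl => /absI[j]; rewrite prodrXl => Ij; exists j, N.
Qed.

(* Test absorption on the sums w_j = sum_(i != j) y_i: their product vanishes
   modulo K, whereas y_l times the product of the w_j with j != l is a power of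
   y_l modulo K. *)
Lemma absorbing_orthogonal {n K} (y : 'I_n.+1 -> R) : (0 < n)%N ->
  absorbing n K -> (forall x m, K (x ^+ m) -> K x) ->
  (forall i j, i != j -> K (y i * y j)) -> exists i, K (y i).
Proof.
move=> n_gt0 [iK absK] radK orth.
pose w j := \sum_(i | i != j) y i.
have yw i : K (y i * w i).
  rewrite mulr_sumr; apply: ideal_sum => // j ji; apply: orth.
  by rewrite eq_sym.
have ypw i (P : pred 'I_n.+1) : P i -> K (y i * \prod_(j | P j) w j).
  by move=> Pi; rewrite (bigD1 i) //= mulrA; exact: idealMr.
have yww j l : j != l -> K (y l * w j - y l * y l).
  move=> jl; rewrite /w (bigD1 l) 1?eq_sym //= mulrDr addrAC subrr add0r mulr_sumr.
  by apply: ideal_sum => // i /andP[_ il]; apply: orth; rewrite eq_sym.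
(* Expand the factor [w ord0]: each of its terms [y i] has [i != ord0], so it meets [w i] among the
   other factors. *)
have [|l Kl] := absK w.
  rewrite (bigD1 ord0) //= {1}/w mulr_suml; apply: ideal_sum => // i i0.
  exact: ypw.
exists l.
suff [m Km] : exists m, K (y l * \prod_(i | i != l) w i - y l ^+ m).
  apply: (radK _ m); rewrite -[_ ^+ m](subKr (y l * \prod_(i | i != l) w i)).
  by apply: idealB => //; exact: idealMl.
elim/big_rec: _ => [|j z jl [m Km]].
  by exists 1%N; rewrite mulr1 expr1 subrr; exact: ideal0.
exists m.+1; rewrite exprS.
have -> : y l * (w j * z) - y l * y l ^+ m =
  (y l * w j - y l * y l) * z + y l * (y l * z - y l ^+ m) by ring.
by apply: idealD => //; [apply: idealMr => //; exact: yww|exact: idealMl].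
Qed.

End Ideals.

(** * Saturations and colon ideals *)

Section Saturation.
Context {R : comPzRingType} {S : mulSubset R}.
Implicit Types (I J K T : set R) (a b r s t x y z : R).

Let SM {s t} : (S : set R) s -> (S : set R) t -> (S : set R) (s * t).
Proof. exact: mulSubset_mul. Qed.

(** The exponent 0 is excluded because [S] may lack 1. *)
Lemma mulSubsetX {s} m : (0 < m)%N -> (S : set R) s -> (S : set R) (s ^+ m).
Proof.
case: m => // m _ Ss; elim: m => [|m IH]; first by rewrite expr1.
by rewrite exprS; exact: SM.
Qed.

Lemma S_saturationP {I} : is_ideal I -> is_ideal (S_saturation S I).
Proof.
move=> iI; have [s0 Ss0] := mulSubset_nonempty S.
split=> [|x y [s Ss Ix] [t St Iy]|r x [s Ss Ix]].
- by exists s0 => //; rewrite mul0r; exact: ideal0.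
- exists (s * t); first exact: SM.
  rewrite mulrDl mulrA [y * _]mulrCA; apply: idealD => //.
    exact: idealMr.
  exact: idealMl.
- by exists s => //; rewrite -mulrA; exact: idealMl.
Qed.

Lemma ideal_colon_sub_S_saturation {I s} :
  (S : set R) s -> ideal_colon I s `<=` S_saturation S I.
Proof. by move=> Ss x Ix; exists s => //; rewrite mulrC. Qed.

(* If no t works, one builds (t_k) in S, each dividing the next, and multiples
   y_k of t_k outside K such that y_k t_(k+1) is in K: the y_k are pairwise
   orthogonal modulo K. *)
Lemma radical_S_saturation {n K} : (0 < n)%N -> absorbing n K ->
  (forall x m, K (x ^+ m) -> K x) ->
  exists2 t, (S : set R) t & S_saturation S K `<=` ideal_colon K t.
Proof.
move=> n_gt0 absK radK; have [iK _] := absK; apply: contrapT => noK.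
have step t : exists xc : R * R, (S : set R) t ->
    [/\ (S : set R) xc.2, ~ K (t * xc.1) & K (xc.1 * xc.2)].
  (* [choice] needs a total function; outside [S] a dummy pair serves. *)
  have [St|nSt] := pselect ((S : set R) t); last by exists (0, 0).
  have [x [[c Sc Kxc] nKx]] : exists x, S_saturation S K x /\ ~ K (t * x).
    apply: contrapT => nox; apply: noK; exists t => // x Qx.
    by apply: contrapT => nKx; apply: nox; exists x.
  by exists (x, c).
have [f fP] := choice step.
have [t0 St0] := mulSubset_nonempty S.
pose t := nat_rect (fun=> R) t0 (fun _ u => u * (f u).2).
have St k : (S : set R) (t k).
  by elim: k => //= k Stk; apply: SM => //; have [] := fP _ Stk.
have tdvd k d : exists c, t (d + k)%N = t k * c.
  elim: d => [|d [c e]]; first by exists 1; rewrite mulr1.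
  by exists (c * (f (t (d + k)%N)).2); rewrite addSn /= e mulrA.
pose y k := t k * (f (t k)).1.
have orth i j : (i < j)%N -> K (y i * y j).
  move=> ij; have [c] := tdvd i.+1 (j - i.+1)%N; rewrite subnK // => e.
  have [_ _ Kxc] := fP _ (St i).
  have -> : y i * y j = (f (t i)).1 * (f (t i)).2 * (t i * t i * c * (f (t j)).1).
    by rewrite /y e /=; ring.
  exact: idealMr.
have [i j|i] := absorbing_orthogonal (fun i : 'I_n.+1 => y i) n_gt0 absK radK.
  rewrite neq_ltn => /orP[|ji]; first exact: orth.
  by rewrite mulrC; exact: orth.
by have [_ nK _] := fP _ (St i).
Qed.

Section Stabilization.
Context {n : nat} {I : set R} {s : R}.
Hypotheses (n_gt0 : (0 < n)%N) (iI : is_ideal I) (disj : I `&` S = set0).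
Hypotheses (Ss : (S : set R) s) (absI : absorbing_upto n s I).

Let SI x : (S : set R) x -> ~ I x.
Proof. by move=> Sx Ix; rewrite -[False]/((set0 : set R) x) -disj. Qed.

(* Absorption on s^(k+1-2n) x and n factors s^2 gains one s and loses two. *)
Let descent1 k x : (2 * n <= k)%N -> I (s ^+ k.+1 * x) -> I (s ^+ k * x).
Proof.
move=> le2nk; have -> : s ^+ k.+1 * x = (s ^+ (k.+1 - 2 * n) * x) * (s ^+ 2) ^+ n.
  by rewrite -exprM mulrAC -exprD subnK // ltnW.
case/(absorbing_uptoX absI) => [|Ix].
  (* Dropping the odd factor would put [s * (s ^+ 2) ^+ n], an element of [S], into [I]. *)
  by move/SI => []; apply: SM => //; do 2 apply: mulSubsetX => //.
suff -> : s ^+ k * x = s * (s ^+ (k.+1 - 2 * n) * x * (s ^+ 2) ^+ n.-1) by [].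
rewrite -exprM mulrAC -exprD mulrA -exprS.
by congr (s ^+ _ * x); case: n n_gt0 le2nk => // m _; lia.
Qed.

(** By iterated descent, the chain of the [I : s^m] is stationary from [m = 2n] on. *)
Lemma colon_stable k x : I (s ^+ (2 * n + k) * x) -> I (s ^+ (2 * n) * x).
Proof.
elim: k => [|k IH]; first by rewrite addn0.
by rewrite addnS => Ix; apply/IH/descent1; rewrite ?leq_addr.
Qed.

(** Absorption for the [s ^+ (2 * n) * r i] leaves a surplus power of [s], which [colon_stable]
    reduces to [s ^+ (2 * n)]. *)
Lemma absorbing_colon : absorbing n (ideal_colon I (s ^+ (2 * n))).
Proof.
split=> [|r Ir]; first exact: ideal_colonP.
have [|j] := absI (fun i => s ^+ (2 * n) * r i).
  rewrite prod_scale cardT size_enum_ord exprSr -mulrA.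
  exact: idealMl.
rewrite prod_scale_but1 -exprM mulrA -exprS => Ij.
exists j; rewrite /ideal_colon /=; apply: (colon_stable (2 * n * n).+1).
by rewrite exprD -mulrA; exact: idealMl.
Qed.

End Stabilization.
End Saturation.

(** * Maximal and prime ideals avoiding a set *)

Section MaximalIdeals.
Context {R : comPzRingType}.
Implicit Types (J P L M T : set R).

(** Zorn's lemma. Taking [T] to be [[set 1]] produces maximal ideals, and a multiplicative subset
    produces primes. *)
Lemma exists_maximal_avoiding {J T} : is_ideal J -> J `<=` ~` T ->
  exists P, [/\ is_ideal P, J `<=` P, P `<=` ~` T
    & forall L, is_ideal L -> P `<=` L -> L `<=` ~` T -> L = P].
Proof.
move=> iJ JT; pose good X := [/\ is_ideal X, J `<=` X & X `<=` ~` T].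
have [F FP totF|P [P0 maxP]] := @Zorn_bigcup R [set X | X = set0 \/ good X].
  have [[X0 [FX0 gX0]]|nogood] := pselect (exists X, F X /\ good X); last first.
    left; apply/seteqP; split=> // x [X FX Xx].
    case: (FP X FX) => [X0|gX]; first by rewrite X0 in Xx.
    by case: nogood; exists X.
  have FI X x : F X -> X x -> good X.
    by move=> /FP[->|//].
  right; split.
  - split.
    + by exists X0 => //; case: gX0 => /ideal0.
    + move=> x y [X FX Xx] [Y FY Yy].
      have [iX _ _] := FI _ _ FX Xx; have [iY _ _] := FI _ _ FY Yy.
      case: (totF X Y FX FY) => [XY|YX].
        by exists Y => //; apply: idealD => //; exact: XY.
      by exists X => //; apply: idealD => //; exact: YX.
    + move=> r x [X FX Xx]; exists X => //; apply: idealMl => //.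
      by have [] := FI _ _ FX Xx.
  - by move=> x Jx; exists X0 => //; case: gX0 => _ + _; apply.
  - by move=> x [X FX Xx]; have [_ _] := FI _ _ FX Xx; apply.
have [iP JP PT] : good P.
  case: P0 => // P0; exfalso; apply: (maxP J); last by right; split.
  by rewrite P0; split=> // J0; have := J0 _ (ideal0 iJ).
exists P; split=> // L iL PL LT; apply/seteqP; split=> //.
apply: contrapT => nLP; apply: (maxP L); first by split.
right; split=> //; exact: subset_trans PL.
Qed.

Lemma exists_maximal_ideal {J} : is_ideal J -> ~ J 1 ->
  exists2 M, is_maximal_ideal M & J `<=` M.
Proof.
move=> iJ J1; have [|M [iM JM M1 maxM]] := @exists_maximal_avoiding J [set 1] iJ.
  by move=> x Jx /= x1; rewrite x1 in Jx.
exists M => //; split=> // [MT|L iL ML]; first by apply: (M1 1) => //; rewrite MT.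
have [L1|nL1] := pselect (L 1).
  right; apply/seteqP; split=> // x _; rewrite -[x]mulr1; exact: idealMl.
by left; apply: maxM => // x Lx /= x1; rewrite x1 in Lx.
Qed.

Lemma ideal_adjoin {P} x : is_ideal P ->
  is_ideal [set z | exists m r, P m /\ z = m + r * x].
Proof.
move=> iP; split.
- by exists 0, 0; split; [exact: ideal0|ring].
- move=> _ _ [m [r [Pm ->]]] [m' [r' [Pm' ->]]].
  by exists (m + m'), (r + r'); split; [exact: idealD|ring].
- move=> c _ [m [r [Pm ->]]].
  by exists (c * m), (c * r); split; [exact: idealMl|ring].
Qed.

(** An ideal [P] maximal among those avoiding [T] is prime: for [x], [y] outside [P], both [P + Rx]
    and [P + Ry] meet [T], and the product of the two meeting points would lie in [P] if [x * y]
    did. *)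
Lemma exists_prime_avoiding {J} {T : mulSubset R} : is_ideal J -> J `<=` ~` T ->
  exists P, [/\ is_prime_ideal P, J `<=` P & P `<=` ~` T].
Proof.
move=> iJ JT; have [P [iP JP PT maxP]] := exists_maximal_avoiding iJ JT.
exists P; split=> //; split=> // [PTT|x y Pxy].
  by have [t Tt] := mulSubset_nonempty T; apply: (PT t) => //; rewrite PTT.
have meets z : ~ P z -> exists m r, P m /\ (T : set R) (m + r * z).
  move=> nPz; apply: contrapT => nmr; apply: nPz.
  rewrite -(maxP _ (ideal_adjoin z iP)).
  - by exists 0, 1; split; [exact: ideal0|ring].
  - by move=> m Pm; exists m, 0; split=> //; ring.
  - by move=> _ [m [r [Pm ->]]] Tz; apply: nmr; exists m, r.
apply: contrapT => /not_orP[/meets[m [r [Pm Tx]]] /meets[m' [r' [Pm' Ty]]]].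
apply: (PT _ _ (mulSubset_mul Tx Ty)).
have -> : (m + r * x) * (m' + r' * y) =
  m * (m' + r' * y) + (r * x * m' + r * r' * (x * y)) by ring.
by apply: idealD => //; [exact: idealMr|apply: idealD => //; exact: idealMl].
Qed.

Lemma prime_idealX {P : set R} {x} n : is_prime_ideal P -> P (x ^+ n) -> P x.
Proof.
case=> iP PT primeP; elim: n => [P1|n IH]; last by rewrite exprS => /primeP[].
by case: PT; apply/seteqP; split=> // z _; rewrite -[z]mulr1; exact: idealMl.
Qed.

Lemma maximal_prime {M : set R} : is_maximal_ideal M -> is_prime_ideal M.
Proof.
move=> maxM; have [iM MT _] := maxM; split=> // x y Mxy.
by apply: contrapT => /not_orP[Mx My]; exact: (maximal_compl_mul maxM Mx My).
Qed.

End MaximalIdeals.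

(** * Extension of ideals to the localization *)

Lemma ideal_generatedP {R : comPzRingType} (X : set R) : is_ideal (ideal_generated X).
Proof.
split=> [J [iJ _]|x y Ix Iy J [iJ XJ]|r x Ix J [iJ XJ]].
- exact: ideal0.
- by apply: idealD => //; [exact: Ix|exact: Iy].
- by apply: idealMl => //; exact: Ix.
Qed.

Section Extension.
Context {R : comPzRingType} {S : mulSubset R}.
Implicit Types (I P : set R) (a b : R) (s t : Localization.denominator S).

Local Notation frac a s := (Localization.fraction a s : localization S).

Lemma denominatorP s : (S : set R) (sval s).
Proof. exact: set_mem (svalP s). Qed.

Lemma fracD a s b t : frac a s + frac b t =
  frac (a * sval t + b * sval s) (Localization.dmul s t).
Proof. exact: Localization.addE. Qed.

Lemma fracM a s b t : frac a s * frac b t = frac (a * b) (Localization.dmul s t).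
Proof. exact: Localization.mulE. Qed.

Lemma extension_ideal I : is_ideal (extension S I).
Proof. exact: ideal_generatedP. Qed.

Lemma extension_frac I a s : is_ideal I ->
  extension S I (frac a s) <-> S_saturation S I a.
Proof.
move=> iI; split=> [Ia|[u Su Iau]].
  (* The fractions with a numerator in [I] form an ideal containing the generators of the
     extension. *)
  pose E : set (localization S) := [set f | exists b t, I b /\ f = frac b t].
  have iE : is_ideal E.
    split.
    - by exists 0, (Localization.base S); split; [exact: ideal0|].
    - move=> _ _ [b [t [Ib ->]]] [c [v [Ic ->]]]; rewrite fracD.
      by do 2 eexists; split; [|reflexivity]; apply: idealD => //; exact: idealMr.
    - move=> r _ [b [t [Ib ->]]]; elim/Localization.fractionW: r => c v.
      by rewrite fracM; do 2 eexists; split; [|reflexivity]; exact: idealMl.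
  have [|b [t [Ib]]] := Ia E.
    split=> // _ [b Ib <-]; do 2 eexists; split; [|reflexivity].
    exact: idealMr.
  case/Localization.fractionP=> u e; exists (sval t * sval u).
    exact: mulSubset_mul (denominatorP _) (denominatorP _).
  have -> : a * (sval t * sval u) = sval u * (a * sval t) by ring.
  by rewrite e; apply: idealMl => //; exact: idealMr.
pose v : Localization.denominator S := exist _ u (mem_set Su).
pose w := Localization.base S.
(* This is a/s = (1/(su)) (au), with 1/(su) written as w/(wsu). *)
have -> : frac a s = frac (sval w) (Localization.dmul w (Localization.dmul s v))
    * to_localization S (a * u).
  rewrite [RHS]fracM; apply/Localization.fractionP.
  by exists w => /=; ring.
apply: (idealMl _ (extension_ideal I)).
by apply: sub_gen_smallest; exists (a * u).
Qed.

Lemma extension_inj I a : is_ideal I ->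
  extension S I (to_localization S a) <-> S_saturation S I a.
Proof.
move=> iI; apply: (iff_trans (extension_frac _ _ _ iI)); split=> -[u Su Iu].
  exists (sval (Localization.base S) * u); last by rewrite mulrA.
  exact: mulSubset_mul (denominatorP _) _.
by exists u => //; rewrite mulrAC; exact: idealMr.
Qed.

Lemma S_saturation_prime P : is_prime_ideal P -> P `<=` ~` S ->
  S_saturation S P `<=` P.
Proof. by case=> _ _ primeP PS x [s Ss /primeP[//|/PS]]. Qed.

Lemma extension_prime P : is_prime_ideal P -> P `<=` ~` S ->
  is_prime_ideal (extension S P).
Proof.
move=> pP PS; have [iP PT primeP] := pP; have satP := S_saturation_prime _ pP PS.
split; first exact: extension_ideal.
  move=> ET; apply: PT; apply/seteqP; split=> // x _; apply: satP.
  by apply/extension_inj; rewrite ?ET.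
elim/Localization.fractionW => a s; elim/Localization.fractionW => b t.
rewrite fracM => /(extension_frac _ _ _ iP)/satP/primeP.
have [s0 Ss0] := mulSubset_nonempty S.
by case=> Px; [left|right]; apply/extension_frac => //; exists s0 => //; exact: idealMr.
Qed.

Lemma absorbing_extension {n I} {s : R} : (0 < n)%N -> is_ideal I -> (S : set R) s ->
  absorbing_upto n s I -> absorbing n (extension S I).
Proof.
move=> n_gt0 iI Ss absI; split=> [|r Ir]; first exact: extension_ideal.
pose a i := Localization.num (r i); pose d i := Localization.den (r i).
have rE i : frac (a i) (d i) = r i := Localization.num_den (r i).
pose b := Localization.base S.
(* Each [r i] is a unit times the image of its numerator, so membership depends on numerators
   only. *)
have extP (P : pred 'I_n.+1) : extension S I (\prod_(i | P i) r i) <->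
    S_saturation S I (\prod_(i | P i) a i).
  rewrite -extension_inj // rmorph_prod; split=> Ir'.
    under eq_bigr => i _.
      have -> : to_localization S (a i) = to_localization S (sval (d i)) * r i.
        by rewrite -rE [RHS]fracM; apply/Localization.fractionP; exists b => /=; ring.
      over.
    by rewrite big_split; exact: (idealMl _ (extension_ideal I)).
  under eq_bigr => i _.
    have -> : r i = frac (sval b) (Localization.dmul b (d i)) * to_localization S (a i).
      by rewrite -rE [RHS]fracM; apply/Localization.fractionP; exists b => /=; ring.
    over.
  by rewrite big_split; exact: (idealMl _ (extension_ideal I)).
have [u Su Iu] := (extP _).1 Ir.
(* Scaling every factor by [u] leaves [s * u ^+ n], an element of [S], whichever index is
   dropped. *)
have [|j] := absI (fun i => u * a i).
  by rewrite prod_scale cardT size_enum_ord exprSr -mulrA [u * _]mulrC; exact: idealMl.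
rewrite prod_scale_but1 => Ij; exists j; apply/extP.
exists (s * u ^+ n); last by rewrite mulrC -mulrA.
exact: mulSubset_mul (mulSubsetX _ n_gt0 Su).
Qed.

End Extension.

(** * Local dividedness and the two implications *)

(** In R_M the prime extended from [P] omits the image of [a], so it lies in the principal ideal of
    [a]; clearing denominators in p = a (c/v) gives [u] and [r]. *)
Lemma locally_divided_lift {R : comPzRingType} {M P : set R} {a p : R} :
  locally_divided R -> is_maximal_ideal M -> is_prime_ideal P -> P `<=` M ->
  ~ P a -> P p -> exists u r, ~ M u /\ u * p = a * r.
Proof.
move=> ldR maxM pP PM nPa Pp; have [iP _ _] := pP.
pose S := maximal_compl maxM.
have PS : P `<=` ~` (S : set R) by move=> x Px nMx; exact/nMx/PM.
have [|] := ldR M maxM _ (extension_prime _ pP PS) (to_localization S a).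
  by move=> /(extension_inj _ _ iP)/(S_saturation_prime _ pP PS).
move=> [/(_ (to_localization S p)) sub _]; have [|f _] := sub.
  by apply: sub_gen_smallest; exists p.
elim/Localization.fractionW: f => c v.
move=> /esym; rewrite [RHS]fracM => /Localization.fractionP[u].
(* The map to R_M sends x to (xb)/b, whence the powers of [b] below. *)
pose b := sval (Localization.base S).
rewrite -[LHS]/(sval u * (p * b * (b * sval v))).
rewrite -[RHS]/(sval u * (a * b * c * b)) => e.
have Sb : (S : set R) b := denominatorP _.
exists (sval u * b * b * sval v), (sval u * b * c * b); split.
  have nM x : ~ M x <-> (S : set R) x by [].
  by apply/nM; do !apply: mulSubset_mul => //; exact: denominatorP.
transitivity (sval u * (p * b * (b * sval v))); first by ring.
by rewrite e; ring.
Qed.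

(* Let Q be the saturation. Some t in S satisfies t^n q^n \in I for all q in Q.
   If t^n x \notin I with x in Q, a maximal M contains I : t^n x, hence Q, and a
   prime P between Q and M avoids S. With x v \in I, v in S, dividedness of P at
   M gives u x = v^n z with u outside M; then v^(n+1) z \in I absorbs to
   v^n z = u x \in I, contradicting u \notin M. *)
Lemma absorbing_S_saturation {R : comPzRingType} {S : mulSubset R} {n I} :
  (0 < n)%N -> locally_divided R -> absorbing n I -> I `&` S = set0 ->
  exists2 t, (S : set R) t & S_saturation S I `<=` ideal_colon I t.
Proof.
move=> n_gt0 ldR absI disj; have [iI abs1] := (absorbing1 _ _).1 absI.
have SI x : (S : set R) x -> ~ I x.
  by move=> Sx Ix; rewrite -[False]/((set0 : set R) x) -disj.
have [t St Kt] : exists2 t, (S : set R) t &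
    S_saturation S (ideal_radical I) `<=` ideal_colon (ideal_radical I) t.
  apply: (radical_S_saturation n_gt0 (absorbing_radical absI)).
  by move=> x m; exact: radical_idealX.
(* [t * q] lies in the radical, and [absorbing_expr] brings the exponent down to [n]. *)
have Qt q : S_saturation S I q -> I (t ^+ n * q ^+ n).
  move=> [v Sv Iqv]; have [|N] := Kt q.
    by exists v => //; exists 1%N; rewrite expr1.
  by rewrite -exprMn; exact: absorbing_expr.
exists (t ^+ n) => [|x Qx]; first exact: mulSubsetX.
apply: contrapT => nIx.
pose A := ideal_colon I (t ^+ n * x).
have [||M maxM AM] := @exists_maximal_ideal R A.
- exact: ideal_colonP.
- by rewrite /A /ideal_colon /= mulr1.
have iQ : is_ideal (S_saturation S I) by exact: S_saturationP.
have QM : S_saturation S I `<=` M.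
  move=> q /Qt Iq; apply: (prime_idealX n (maximal_prime maxM)).
  by apply: AM; rewrite /A /ideal_colon /= mulrAC; exact: idealMr.
(* Avoiding the products of [S] with the complement of [M] forces a prime both to avoid [S] and to
   lie in [M]. *)
pose T := [set z | exists s u, [/\ (S : set R) s, ~ M u & z = s * u]].
have T0 : T !=set0.
  have [s Ss] := mulSubset_nonempty S.
  by exists s, s, 1; split; rewrite ?mulr1 //; exact: maximal_not1.
have mulT a b : T a -> T b -> T (a * b).
  move=> [s [u [Ss Mu ->]]] [s' [u' [Ss' Mu' ->]]]; exists (s * s'), (u * u').
  split; [exact: mulSubset_mul|exact: (maximal_compl_mul maxM)|ring].
have [|P [pP QP PT]] := @exists_prime_avoiding R _ (MulSubset T0 mulT) iQ.
  move=> q [v Sv Iv] [s [u [Ss Mu e]]]; rewrite {}e in Iv; apply/Mu/QM.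
  exists (s * v); first exact: mulSubset_mul.
  by rewrite mulrCA mulrA.
have PM : P `<=` M.
  move=> u Pu; apply: contrapT => Mu; apply: (PT (t * u)); last by exists t, u.
  by apply: idealMl => //; case: pP.
have [v Sv Ixv] := Qx.
have nPv : ~ P (v ^+ n).
  move=> Pv; apply: (PT (v ^+ n)) => //; exists (v ^+ n), 1.
  by split; rewrite ?mulr1 //; [exact: mulSubsetX|exact: maximal_not1].
have [u [z [Mu e]]] := locally_divided_lift ldR maxM pP PM nPv (QP _ Qx).
apply/Mu/AM; rewrite /A /ideal_colon /= -mulrA [x * u]mulrC; apply: idealMl => //.
have : I (v * z * v ^+ n).
  by rewrite -mulrA [z * _]mulrC -e mulrCA [v * x]mulrC; exact: idealMl.
case/(absorbing_uptoX abs1); rewrite mul1r; first by move/SI => []; exact: mulSubsetX.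
by rewrite mulrAC -exprS prednK // -e.
Qed.

Theorem theorem3p5 (R : comPzRingType) (S : mulSubset R) (I : set R) (n : nat)
    (idealI : is_ideal I) (disjIS : I `&` S = set0) (n_gt0 : (0 < n)%N) :
  (absorbing n (extension S I) ->
   (exists2 s : R, (S : set R) s & S_saturation S I = ideal_colon I s) ->
   S_absorbing S n I)
  /\
  (locally_divided R -> S_absorbing S n I ->
   absorbing n (extension S I) /\
   (exists2 s : R, (S : set R) s & S_saturation S I = ideal_colon I s)).
Proof.
split=> [[_ absE] [s Ss satI]|ldR [_ _ [s Ss absI]]].
  (* Absorb in the localization; the shortened product then contracts into the saturation, which is
     [I : s]. *)
  split=> //; exists s => // r Ir; have [|j] := absE (fun i => to_localization S (r i)).
    by rewrite -rmorph_prod; apply: sub_gen_smallest; exists (\prod_(i < n.+1) r i).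
  by rewrite -rmorph_prod => /(extension_inj _ _ idealI); rewrite satI; exists j.
split; first exact: absorbing_extension absI.
have Sm : (S : set R) (s ^+ (2 * n)) by apply: mulSubsetX => //; rewrite muln_gt0.
have absJ := absorbing_colon n_gt0 idealI disjIS Ss absI.
have [|t St satJ] := absorbing_S_saturation (S := S) n_gt0 ldR absJ.
  apply/seteqP; split=> // x [Ix Sx].
  rewrite -[set0 x]/(set0 (s ^+ (2 * n) * x)) -disjIS.
  by split => //; exact: mulSubset_mul.
(* [t] carries the saturation of [I : s^(2n)], which contains that of [I], into [I : s^(2n)]; the
   further factor [s ^+ (2 * n)] lands in [I]. *)
exists (s ^+ (2 * n) * t); first exact: mulSubset_mul.
apply/seteqP; split; last by apply: ideal_colon_sub_S_saturation; exact: mulSubset_mul.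
move=> x [v Sv Ixv]; rewrite /ideal_colon /= -mulrA; apply: satJ.
by exists v => //; rewrite /ideal_colon /=; exact: idealMl.
Qed.
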